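(* Let $G$ be a modular graph with at least three vertices. Then $$SWW_3(G) = \frac{|V(G)|-2}{4}W(G) + \frac{|V(G)|-2}{8}\overline{WW}(G) + \frac18\widehat{WW}(G).$$
   Context: All graphs are finite, simple and connected; $d(u,v)$ is the shortest-path distance. A median of vertices $u,v,w$ is a vertex lying on a shortest $u,v$-path, a shortest $u,w$-path and a shortest $v,w$-path; $G$ is modular if every triple of vertices has at least one median. For nonempty $S\subseteq V(G)$, the Steiner distance $d(S)$ is the minimum number of edges of a connected subgraph whose vertex set contains $S$. $SWW_3(G)=\frac12\sum_{S\subseteq V(G),|S|=3}d(S)+\frac12\sum_{S\subseteq V(G),|S|=3}d(S)^2$. $W(G)=\sum_{\{u,v\}\subseteq V(G)}d(u,v)$ and $\overline{WW}(G)=\sum_{\{u,v\}\subseteq V(G)}d(u,v)^2$ (sums over unordered pairs of distinct vertices). $O_3(G)$ is the set of ordered triples $(u,v,w)$ of pairwise distinct vertices, and $\widehat{WW}(G)=\sum_{(u,v,w)\in O_3(G)} d(u,v)d(u,w)$. *)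

(* Defs.v *)
From mathcomp Require Import all_boot all_order all_algebra.

Set Implicit Arguments.
Unset Strict Implicit.
Unset Printing Implicit Defensive.

Import GRing.Theory.

(* A graph is an adjacency relation on a finite type of vertices. *)
Definition simple_graph (T : finType) (e : rel T) : Prop :=
  symmetric e /\ irreflexive e.

Definition connected_graph (T : finType) (e : rel T) : Prop :=
  forall u v : T, connect e u v.

(* The path has vertex sequence u :: p, hence size p edges. *)
Definition uv_path (T : finType) (e : rel T) (u v : T) (p : seq T) : bool :=
  [&& path e u p, last u p == v & uniq (u :: p)].

(* A path has fewer than #|T| edges, so the range of the search below loses
   nothing; the value is #|T| when u and v are not connected. *)
Definition dist (T : finType) (e : rel T) (u v : T) : nat :=
  find (fun n => [exists p : n.-tuple T, uv_path e u v p]) (iota 0 #|T|).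

Definition shortest_path (T : finType) (e : rel T) (u v : T) (p : seq T) : Prop :=
  uv_path e u v p /\ size p = dist e u v.

Definition on_shortest_path (T : finType) (e : rel T) (u v m : T) : Prop :=
  exists2 p : seq T, shortest_path e u v p & m \in u :: p.

Definition median (T : finType) (e : rel T) (u v w m : T) : Prop :=
  [/\ on_shortest_path e u v m,
      on_shortest_path e u w m &
      on_shortest_path e v w m].

Definition modular_graph (T : finType) (e : rel T) : Prop :=
  forall u v w : T, exists m : T, median e u v w m.

Definition edges (T : finType) (e : rel T) : {set {set T}} :=
  [set E : {set T} | [exists x, exists y, e x y && (E == [set x; y])]].

(* H.1 is the vertex set and H.2 the edge set of the candidate subgraph. *)
Definition subgraph (T : finType) (e : rel T)
    (H : {set T} * {set {set T}}) : bool :=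
  (H.2 \subset edges e) && [forall E in H.2, E \subset H.1].

Definition subgraph_connected (T : finType)
    (H : {set T} * {set {set T}}) : bool :=
  [forall x in H.1, forall y in H.1,
    connect (fun a b => [set a; b] \in H.2) x y].

(* The default argument (setT, edges e) is the whole graph, which is a valid
   candidate as soon as the graph is connected. *)
Definition steiner_dist (T : finType) (e : rel T) (S : {set T}) : nat :=
  #|[arg min_(H < (setT, edges e)
       | [&& subgraph e H, subgraph_connected H & S \subset H.1])
     #|H.2| ].2|.

Definition SWW3 (T : finType) (e : rel T) : rat :=
  (1 / 2 * (\sum_(S : {set T} | #|S| == 3%N) steiner_dist e S)%N%:R
   + 1 / 2 * (\sum_(S : {set T} | #|S| == 3%N) steiner_dist e S ^ 2)%N%:R)%R.

(* Unordered pairs {u, v} of distinct vertices are represented by the ordered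
   pair that is increasing for the enumeration of T. *)
Definition Wiener (T : finType) (e : rel T) : nat :=
  \sum_(uv : T * T | enum_rank uv.1 < enum_rank uv.2) dist e uv.1 uv.2.

Definition WWbar (T : finType) (e : rel T) : nat :=
  \sum_(uv : T * T | enum_rank uv.1 < enum_rank uv.2) dist e uv.1 uv.2 ^ 2.

Definition O3 (T : finType) : {set T * T * T} :=
  [set t | [&& t.1.1 != t.1.2, t.1.1 != t.2 & t.1.2 != t.2]].

Definition WWhat (T : finType) (e : rel T) : nat :=
  \sum_(t in O3 T) dist e t.1.1 t.1.2 * dist e t.1.1 t.2.

(* Main.v *)
Require Import Defs.
From mathcomp Require Import all_boot all_order all_algebra.
From mathcomp Require Import zify ring lra.

(**
In a connected graph every triple satisfies
[2 * d {u, v, w} >= d u v + d u w + d v w]: a connected subgraph containing the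
triple contains a path [p] from [u] to [v] and an edge-disjoint path from a
vertex of [p] to [w].  A median [m] gives the reverse inequality, through the
union of shortest paths from [m] to [u], [v] and [w].  The formula then follows
by summing the equality and its square over ordered triples, each 3-set being
counted six times.
*)

Set Implicit Arguments.
Unset Strict Implicit.
Unset Printing Implicit Defensive.

(** * The distance as a bounded search, and shortest paths *)

Lemma uniq_leq_card (T : finType) (s : seq T) : uniq s -> size s <= #|T|.
Proof. by move/card_uniqP <-; apply: max_card. Qed.

Section Dist.
Variables (T : finType) (e : rel T).

(** Any walk shortens to a simple path whose length lies in the searched range, and [find] cannot
    pass over that length. *)
Lemma dist_le u v p : path e u p -> last u p = v -> dist e u v <= size p.
Proof.
move=> ep; case/shortenP: ep => q eq uq le_qp lv.
apply: leq_trans (uniq_leq_size (andP uq).2 le_qp).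
have lt_q : size q < #|T| by rewrite -[(size q).+1]/(size (u :: q)) uniq_leq_card.
rewrite leqNgt; apply/negP => /(before_find 0).
rewrite nth_iota // add0n => /existsP; apply.
by exists (in_tuple q); rewrite /uv_path /= eq lv eqxx.
Qed.

Hypothesis conn : connected_graph e.

Lemma shortest_path_exists u v : exists p, shortest_path e u v p.
Proof.
have has_p : has (fun n => [exists p : n.-tuple T, uv_path e u v p]) (iota 0 #|T|).
  have /connectP[p ep lv] := conn u v.
  case/shortenP: ep lv => q eq uq _ lv.
  apply/hasP; exists (size q).
    rewrite mem_iota /= add0n -[(size q).+1]/(size (u :: q)).
    by rewrite uniq_leq_card.
  by apply/existsP; exists (in_tuple q); rewrite /uv_path eq -lv eqxx.
have /existsP[p puv] := nth_find 0 has_p.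
exists p; split=> //; rewrite size_tuple nth_iota //.
by rewrite -[X in _ < X](size_iota 0) -has_find.
Qed.

Hypothesis sym : symmetric e.

Lemma dist_le_sym u v : dist e v u <= dist e u v.
Proof.
have [p [/and3P[ep /eqP lv _] <-]] := shortest_path_exists u v.
(* The reverse of [u :: p] is [v :: rev (belast u p)]. *)
rewrite -(size_belast u p) -(size_rev (belast u p)); apply: dist_le.
  rewrite -lv rev_path; apply: sub_path ep => x y; by rewrite sym.
by case: p lv {ep} => [|a p] //= <-; rewrite rev_cons last_rcons.
Qed.

Lemma dist_sym u v : dist e u v = dist e v u.
Proof. by apply/eqP; rewrite eqn_leq !dist_le_sym. Qed.

Lemma on_shortest_path_dist u v m :
  on_shortest_path e u v m -> dist e m u + dist e m v <= dist e u v.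
Proof.
case=> p [/and3P[ep /eqP lv _] <-] m_p; rewrite (dist_sym m u).
case/splitPl: p / m_p ep lv => p1 p2 lm.
rewrite cat_path last_cat lm size_cat => /andP[ep1 ep2] lv.
by apply: leq_add; apply: dist_le.
Qed.

End Dist.

(** * Edge sequences of paths *)

Section PathEdges.
Variable T : finType.

Definition path_edges (x : T) (p : seq T) : seq {set T} :=
  pairmap (fun a b => [set a; b]) x p.

Lemma path_edges_sub x p E a :
  E \in path_edges x p -> a \in E -> a \in x :: p.
Proof.
elim: p x => //= y p IHp x; rewrite inE => /orP[/eqP-> | /IHp in_p].
  by rewrite !inE => /orP[] ->; rewrite ?orbT.
by move=> /in_p; rewrite !inE => ->; rewrite orbT.
Qed.

(** The witness lies in [p], not merely in [x :: p]: a path that meets another one only at its start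
    therefore shares no edge with it. *)
Lemma path_edges_meet x p E :
  E \in path_edges x p -> exists2 a, a \in E & a \in p.
Proof.
elim: p x => //= y p IHp x; rewrite inE => /orP[/eqP-> | /IHp[a aE ap]].
  by exists y; rewrite !inE eqxx ?orbT.
by exists a => //; rewrite inE ap orbT.
Qed.

Lemma path_edges_uniq x p : uniq (x :: p) -> uniq (path_edges x p).
Proof.
elim: p x => //= y p IHp x /andP[x_yp u_yp]; rewrite IHp // andbT.
apply: contra x_yp => /path_edges_sub; apply.
by rewrite !inE eqxx.
Qed.

Lemma path_edgesE (F : {set {set T}}) x p :
  path (fun a b => [set a; b] \in F) x p = all (mem F) (path_edges x p).
Proof. by elim: p x => //= y p IHp x; rewrite IHp. Qed.

Lemma path_edges_edges (e : rel T) x p :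
  path e x p -> {subset path_edges x p <= edges e}.
Proof.
elim: p x => //= y p IHp x /andP[exy ep] E; rewrite inE => /orP[/eqP-> | ].
  by rewrite inE; apply/existsP; exists x; apply/existsP; exists y; rewrite exy /=.
exact: IHp.
Qed.

(** Irreflexivity excludes the singleton [[set a; a]], and symmetry settles the orientation of the
    unordered pair. *)
Lemma mem_edges (e : rel T) a b :
  symmetric e -> irreflexive e -> [set a; b] \in edges e -> e a b.
Proof.
move=> sym irr; rewrite inE => /existsP[x /existsP[y /andP[exy /eqP E]]].
have ne : x != y by apply: contraTneq exy => ->; rewrite irr.
have: #|[set a; b]| = 2 by rewrite E cards2 ne.
rewrite cards2; case: eqVneq => // ab _.
have: a \in [set x; y] by rewrite -E !inE eqxx.
have: b \in [set x; y] by rewrite -E !inE eqxx orbT.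
rewrite !inE => /orP[] /eqP eb /orP[] /eqP ea; subst a b => //.
- by rewrite eqxx in ab.
- by rewrite sym.
- by rewrite eqxx in ab.
Qed.

End PathEdges.

(** * Steiner distance of a triple *)

Section Steiner.
Variables (T : finType) (e : rel T).
Hypotheses (sym : symmetric e) (irr : irreflexive e) (conn : connected_graph e).

Lemma connected_subgraph_size (H : {set T} * {set {set T}}) u v w :
  subgraph e H -> subgraph_connected H -> [set u; v; w] \subset H.1 ->
  dist e u v + dist e u w + dist e v w <= 2 * #|H.2|.
Proof.
case: H => V F /andP[/= Fe _] /forall_inP /= cF sV.
pose r a b := [set a; b] \in F.
have re : subrel r e by move=> a b /(subsetP Fe); apply: mem_edges.
have rsym : symmetric r by move=> a b; rewrite /r setUC.
have inV x : x \in [set u; v; w] -> x \in V by apply: (subsetP sV).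
have uV : u \in V by apply: inV; rewrite !inE eqxx.
have vV : v \in V by apply: inV; rewrite !inE eqxx !orbT.
have wV : w \in V by apply: inV; rewrite !inE eqxx !orbT.
have /connectP[p0 rp0 lp0] : connect r u v by apply: (forall_inP (cF u uV)).
case/shortenP: rp0 lp0 => p rp up _ lp {p0}.
(* Among the paths from [p] to [w], a shortest one leaves [p] immediately. *)
have [q [a [a_p rq lq uq dq]]] : exists q a,
    [/\ a \in u :: p, path r a q, w = last a q, uniq (a :: q)
      & ~~ has (mem (u :: p)) q].
  have /connectP[q0 rq0 lq0] : connect r u w by apply: (forall_inP (cF u uV)).
  have: u \in u :: p by rewrite inE eqxx.
  (* The start becomes an arbitrary vertex [b] of [u :: p], so that the induction can restart at a
     later vertex [c] where the path returns to [u :: p]. *)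
  move: {1 2 3}u rq0 lq0 => b.
  elim: {q0}(size q0) {-2}q0 (leqnn (size q0)) b => [|n IHn] q0 le_n b rq0 lq0 b_p.
    by case: q0 le_n rq0 lq0 => // _ _ lb; exists [::], b; split.
  case/shortenP: rq0 lq0 => q rq uq /(uniq_leq_size (andP uq).2) le_q lq.
  have [/hasP[c c_q /= c_p] | dq] := boolP (has (mem (u :: p)) q); last first.
    by exists q, b.
  case/splitPr: c_q rq lq le_q {uq} => q1 q2.
  rewrite cat_path last_cat /= size_cat /= => /and3P[_ _ rq2] lq2 le_q.
  by apply: (IHn q2 _ c) => //; lia.
(* Both paths are simple and every edge of [q] has an end outside [u :: p], so all these edges are
   distinct elements of [F]. *)
have lin : size p + size q <= #|F|.
  have <- : size (path_edges u p ++ path_edges a q) = size p + size q.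
    by rewrite size_cat !size_pairmap.
  rewrite cardE; apply: uniq_leq_size.
    rewrite cat_uniq !path_edges_uniq // andbT.
    apply/hasPn => E /path_edges_meet[c cE cq].
    apply: contra dq => /path_edges_sub/(_ cE) cp.
    by apply/hasP; exists c.
  move=> E; rewrite mem_enum mem_cat.
  move: rp rq; rewrite !path_edgesE => /allP rp /allP rq.
  by case/orP => [/rp | /rq].
have ep : path e u p by apply: sub_path rp.
have eq : path e a q by apply: sub_path rq.
have duv := dist_le ep (esym lp).
(* Once [p] is cut at [a] into [p1] and [p2], the three distances are bounded by the pairwise sums
   of the sizes of [p1], [p2] and [q], so each size counts twice. *)
case/splitPl: p / a_p lin ep lp duv {rp up dq} => p1 p2 la.
rewrite cat_path last_cat la size_cat => lin /andP[ep1 ep2] lp duv.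
have duw : dist e u w <= size (p1 ++ q).
  by apply: dist_le; rewrite ?cat_path ?last_cat la ?ep1.
have dav : dist e v a <= size p2 by rewrite dist_sym //; apply: dist_le.
(* A shortest path [p3] from [v] to [a] stands in for the reversal of [p2]. *)
have [p3 [/and3P[ep3 /eqP la3 _] sp3]] := shortest_path_exists conn v a.
have dvw : dist e v w <= size (p3 ++ q).
  by apply: dist_le; rewrite ?cat_path ?last_cat la3 ?ep3.
move: duw dvw dav duv lin sp3; rewrite !size_cat /=.
(* The sizes carry convertible but distinct element types, which [lia] would
   treat as unrelated. *)
by move: (size p1) (size p2) (size p3) (size q); lia.
Qed.

Lemma median_subgraph u v w m : median e u v w m ->
  exists H : {set T} * {set {set T}},
    [&& subgraph e H, subgraph_connected H & [set u; v; w] \subset H.1]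
    /\ 2 * #|H.2| <= dist e u v + dist e u w + dist e v w.
Proof.
case=> /(on_shortest_path_dist conn sym) duv /(on_shortest_path_dist conn sym) duw
  /(on_shortest_path_dist conn sym) dvw.
have [p1 [/and3P[ep1 /eqP l1 _] s1]] := shortest_path_exists conn m u.
have [p2 [/and3P[ep2 /eqP l2 _] s2]] := shortest_path_exists conn m v.
have [p3 [/and3P[ep3 /eqP l3 _] s3]] := shortest_path_exists conn m w.
pose es := path_edges m p1 ++ path_edges m p2 ++ path_edges m p3.
pose F := [set E in es].
pose V := [set x in m :: (p1 ++ p2 ++ p3)].
exists (V, F); split; last first.
  (* The three paths may share edges, hence only a bound on [#|F|]. Adding the three median
     inequalities counts each distance from [m] twice. *)
  apply: (@leq_trans (2 * size es)).
    by rewrite leq_mul2l cardsE card_size.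
  rewrite /es !size_cat !size_pairmap; move: s1 s2 s3.
  by move: (size p1) (size p2) (size p3); lia.
pose r a b := [set a; b] \in F.
have rsym : symmetric r by move=> a b; rewrite /r setUC.
have r1 : path r m p1.
  by rewrite path_edgesE; apply/allP => E E1; rewrite /= inE !mem_cat E1.
have r2 : path r m p2.
  by rewrite path_edgesE; apply/allP => E E2; rewrite /= inE !mem_cat E2 orbT.
have r3 : path r m p3.
  by rewrite path_edgesE; apply/allP => E E3; rewrite /= inE !mem_cat E3 !orbT.
have mV x : (x \in V) = [|| x \in m :: p1, x \in m :: p2 | x \in m :: p3].
  by rewrite !inE !mem_cat; case: eqP.
apply/and3P; split.
- apply/andP; split; [apply/subsetP | apply/forall_inP] => E /=.
    by rewrite inE !mem_cat => /or3P[]; apply: path_edges_edges.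
  rewrite inE !mem_cat => E_es; apply/subsetP => x xE.
  by rewrite mV; case/or3P: E_es => /path_edges_sub/(_ xE) ->; rewrite ?orbT.
- have cm x : x \in V -> connect r m x.
    by rewrite mV => /or3P[]; apply: path_connect.
  apply/forall_inP => x /cm mx; apply/forall_inP => y /cm my.
  by apply: connect_trans my; rewrite (sym_connect_sym rsym).
- apply/subsetP => x; rewrite in_setU in_set2 in_set1 mV /=.
  by case/orP => [/orP[]|] /eqP ->; rewrite -?l1 -?l2 -?l3 mem_last ?orbT.
Qed.

Lemma steiner_dist_modular u v w : modular_graph e ->
  2 * steiner_dist e [set u; v; w] = dist e u v + dist e u w + dist e v w.
Proof.
move=> modular_e; have [m med] := modular_e u v w.
have [H [HP le_H]] := median_subgraph med.
rewrite /steiner_dist; case: arg_minnP => [|K /and3P[K1 K2 K3] minK].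
  apply/and3P; split; last exact: subsetT.
    apply/andP; split=> //; apply/forall_inP => E _; exact: subsetT.
  apply/forall_inP => x _; apply/forall_inP => y _ /=.
  apply: connect_sub (conn x y) => a b eab; apply: connect1.
  by rewrite inE; apply/existsP; exists a; apply/existsP; exists b; rewrite eab /=.
(* The lower bound applies to the minimiser [K] itself; the upper bound compares [K] with the median
   subgraph [H]. *)
apply/eqP; rewrite eqn_leq connected_subgraph_size // andbT.
by apply: leq_trans le_H; rewrite leq_mul2l minK.
Qed.

End Steiner.

(** * Ordered triples against 3-sets and pairs *)

Section Counting.
Variable T : finType.

Lemma card_O3_fiber (S : {set T}) : #|S| = 3 ->
  #|[set t in O3 T | [set t.1.1; t.1.2; t.2] == S]| = 6.
Proof.
move=> S3.
have [a [b [c [ab ac bc ->]]]] : exists a b c,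
    [/\ a != b, a != c, b != c & S = [set a; b; c]].
  have /card_gt0P[a aS] : 0 < #|S| by rewrite S3.
  have := cardsD1 a S; rewrite aS S3 add1n => /eqP; rewrite eqSS eq_sym => /cards2P[b [c [bc Sa]]].
  have /setD1P[ba _] : b \in S :\ a by rewrite Sa !inE eqxx.
  have /setD1P[ca _] : c \in S :\ a by rewrite Sa !inE eqxx orbT.
  exists a, b, c; split; rewrite // 1?eq_sym //.
  by rewrite -setUA -Sa setD1K.
pose s := [:: (a, b, c); (a, c, b); (b, a, c); (b, c, a); (c, a, b); (c, b, a)].
have us : uniq s.
  by rewrite /s /= !inE !xpair_eqE !eqxx /= (eq_sym b a) (eq_sym c a) (eq_sym c b)
    (negbTE ab) (negbTE ac) (negbTE bc).
rewrite -[6]/(size s) -(card_uniqP us); apply: eq_card => -[[x y] z].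
rewrite inE [_ \in O3 T]inE /=.
apply/andP/idP => [[/and3P[xy xz yz] /eqP E] | ].
  have: x \in [set a; b; c] by rewrite -E !inE eqxx.
  have: y \in [set a; b; c] by rewrite -E !inE eqxx !orbT.
  have: z \in [set a; b; c] by rewrite -E !inE eqxx !orbT.
  rewrite !in_setU !in_set1 -!orbA.
  (* Of the 27 assignments, those repeating a vertex contradict distinctness; the other six are
     listed in [s]. *)
  by case/or3P => /eqP ?; case/or3P => /eqP ?; case/or3P => /eqP ?; subst x y z;
    rewrite ?eqxx // in xy xz yz *; rewrite /s !inE !eqxx ?orbT.
rewrite /s !inE !xpair_eqE => xyz.
have [ba ca cb] : [/\ b != a, c != a & c != b].
  by rewrite !(eq_sym c) (eq_sym b).
have -> : [set x; y; z] == [set a; b; c].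
  apply/eqP/setP => t; move: xyz; rewrite !inE.
  by case/or4P => [|||/or3P[]] /andP[/andP[/eqP-> /eqP->] /eqP->];
    case: (t == a); case: (t == b); case: (t == c).
by move: xyz; case/or4P => [|||/or3P[]] /andP[/andP[/eqP-> /eqP->] /eqP->];
  rewrite ?ab ?ac ?bc ?ba ?ca ?cb.
Qed.

Lemma sum_O3_set (G : {set T} -> nat) :
  \sum_(t in O3 T) G [set t.1.1; t.1.2; t.2]
  = 6 * \sum_(S : {set T} | #|S| == 3) G S.
Proof.
rewrite (partition_big (fun t => [set t.1.1; t.1.2; t.2])
  (fun S : {set T} => #|S| == 3)) /=; last first.
  move=> [[x y] z]; rewrite inE /= => /and3P[xy xz yz].
  by rewrite setUC cardsU1 cards2 !inE xy
    (eq_sym z x) (eq_sym z y) (negbTE xz) (negbTE yz).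
rewrite big_distrr; apply: eq_bigr => S /eqP S3.
rewrite (eq_bigr (fun _ => G S)) => [|t /andP[_ /eqP->] //].
rewrite sum_nat_const -(card_O3_fiber S3); congr (_ * _).
by apply: eq_card => t; rewrite [RHS]inE.
Qed.

Lemma sum_O3_swap12 (G : T -> T -> T -> nat) :
  \sum_(t in O3 T) G t.1.1 t.1.2 t.2 = \sum_(t in O3 T) G t.1.2 t.1.1 t.2.
Proof.
rewrite (reindex_inj (h := fun t : T * T * T => (t.1.2, t.1.1, t.2))) /=.
  by apply: eq_bigl => -[[x y] z]; rewrite !inE /= eq_sym; congr (_ && _); rewrite andbC.
by move=> [[x y] z] [[x' y'] z'] [-> -> ->].
Qed.

Lemma sum_O3_swap23 (G : T -> T -> T -> nat) :
  \sum_(t in O3 T) G t.1.1 t.1.2 t.2 = \sum_(t in O3 T) G t.1.1 t.2 t.1.2.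
Proof.
rewrite (reindex_inj (h := fun t : T * T * T => (t.1.1, t.2, t.1.2))) /=.
  by apply: eq_bigl => -[[x y] z]; rewrite !inE /= (eq_sym z y) andbCA.
by move=> [[x y] z] [[x' y'] z'] [-> -> ->].
Qed.

(** A pair of distinct vertices has [#|T| - 2] choices of third vertex, and each unordered pair
    arises in two orders. The truncated subtraction is harmless: if [#|T| < 2], both sums are
    empty. *)
Lemma sum_O3_pair (f : T -> T -> nat) : (forall x y, f x y = f y x) ->
  \sum_(t in O3 T) f t.1.1 t.1.2
  = 2 * (#|T| - 2) * \sum_(uv : T * T | enum_rank uv.1 < enum_rank uv.2) f uv.1 uv.2.
Proof.
move=> fsym.
have -> : \sum_(t in O3 T) f t.1.1 t.1.2
    = \sum_(uv : T * T | uv.1 != uv.2) (#|T| - 2) * f uv.1 uv.2.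
  rewrite (eq_bigl (fun t : T * T * T =>
    (t.1.1 != t.1.2) && (t.2 \notin [set t.1.1; t.1.2]))).
    rewrite -(pair_big_dep (fun uv : T * T => uv.1 != uv.2)
      (fun uv w => w \notin [set uv.1; uv.2]) (fun uv w => f uv.1 uv.2)) /=.
    apply: eq_bigr => -[x y] /= xy; rewrite sum_nat_const; congr (_ * _).
    have := cardsC [set x; y]; rewrite cards2 xy => <-; rewrite addKn.
    by apply: eq_card => z; rewrite [RHS]inE.
  by move=> [[x y] z]; rewrite !inE /= negb_or !(eq_sym z).
rewrite -big_distrr mulnAC [RHS]mulnC; congr (_ * _).
(* Ordered pairs split into increasing and decreasing ones, and the swap carries the second half to
   the first. *)
rewrite (bigID (fun uv : T * T => enum_rank uv.1 < enum_rank uv.2)) /= mul2n -addnn.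
have ne (x y : T) : (x != y) = (nat_of_ord (enum_rank x) != enum_rank y).
  by rewrite (inj_eq val_inj) (inj_eq enum_rank_inj).
congr (_ + _).
  by apply: eq_bigl => -[x y] /=; rewrite ne; case: ltngtP.
rewrite (reindex_inj (h := fun t : T * T => (t.2, t.1))) /=.
  apply: eq_big => [[x y] /= | [x y] _ /=]; last exact: fsym.
  by rewrite ne; case: ltngtP.
by move=> [x y] [x' y'] [-> ->].
Qed.

End Counting.

(** * The two sums over 3-sets *)

Section Sums.
Variables (T : finType) (e : rel T).
Hypotheses (sym : symmetric e) (irr : irreflexive e) (conn : connected_graph e).
Hypothesis modular_e : modular_graph e.

Let d := dist e.
Let dC x y : d x y = d y x. Proof. exact: dist_sym. Qed.

Lemma sum_steiner_dist :
  2 * \sum_(S : {set T} | #|S| == 3) steiner_dist e S = (#|T| - 2) * Wiener e.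
Proof.
have := sum_O3_set (fun S => 2 * steiner_dist e S).
rewrite -[in RHS]big_distrr.
rewrite (eq_bigr (fun t => d t.1.1 t.1.2 + d t.1.1 t.2 + d t.1.2 t.2)); last first.
  by move=> t _; rewrite steiner_dist_modular.
rewrite !big_split /= -(sum_O3_swap12 (fun x y z => d x z)).
rewrite -(sum_O3_swap23 (fun x y z => d x y)) (@sum_O3_pair T d dC).
(* Each of the three terms gives [2 * (#|T| - 2) * Wiener e], against 12 times the Steiner sum. *)
by rewrite -/(Wiener e); move: (#|T| - 2); lia.
Qed.

Lemma sum_steiner_dist_sqr :
  4 * \sum_(S : {set T} | #|S| == 3) steiner_dist e S ^ 2
  = (#|T| - 2) * WWbar e + WWhat e.
Proof.
have := sum_O3_set (fun S => 4 * steiner_dist e S ^ 2).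
rewrite -[in RHS]big_distrr.
(* Each cross product is written with its common vertex first, so that coordinate swaps turn it into
   the summand of [WWhat]. *)
rewrite (eq_bigr (fun t => d t.1.1 t.1.2 ^ 2 + d t.1.1 t.2 ^ 2 + d t.1.2 t.2 ^ 2
  + 2 * (d t.1.1 t.1.2 * d t.1.1 t.2 + d t.1.2 t.1.1 * d t.1.2 t.2
         + d t.2 t.1.1 * d t.2 t.1.2))); last first.
  move=> t _; rewrite -[4]/(2 ^ 2) -expnMn steiner_dist_modular // -/d.
  by rewrite (dC t.1.2 t.1.1) !(dC t.2); ring.
rewrite big_split -[X in _ + X = _]big_distrr !big_split /=.
rewrite -(sum_O3_swap12 (fun x y z => d x z ^ 2)).
rewrite -(sum_O3_swap23 (fun x y z => d x y ^ 2)).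
rewrite (@sum_O3_pair T (fun x y => d x y ^ 2)); last by move=> x y; rewrite dC.
rewrite -(sum_O3_swap12 (fun x y z => d x y * d x z)).
(* Bringing the third vertex to the front takes two swaps. *)
rewrite (sum_O3_swap23 (fun x y z => d z x * d z y)).
rewrite -(sum_O3_swap12 (fun x y z => d x y * d x z)).
by rewrite -/(WWbar e) -/(WWhat e); move: (#|T| - 2); lia.
Qed.

End Sums.

Theorem theorem4p3 (T : finType) (e : rel T)
    (simple_e : simple_graph e) (connected_e : connected_graph e)
    (modular_e : modular_graph e) (card_T : (3 <= #|T|)%N) :
  (SWW3 e = (#|T|%:R - 2) / 4 * (Wiener e)%:R
            + (#|T|%:R - 2) / 8 * (WWbar e)%:R
            + 1 / 8 * (WWhat e)%:R :> rat)%R.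
Proof.
have [sym irr] := simple_e.
have := congr1 (fun n => n%:R%R : rat) (sum_steiner_dist sym irr connected_e modular_e).
have := congr1 (fun n => n%:R%R : rat) (sum_steiner_dist_sqr sym irr connected_e modular_e).
(* [card_T] makes the natural subtraction [#|T| - 2] agree with the rational one. *)
rewrite !(GRing.natrD, GRing.natrM) GRing.natrB; last exact: ltnW.
rewrite /SWW3; lra.
Qed.
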